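(* Let $\Omega\subset\mathbb{R}^d$ be open and let $F[u](x)=F(x,u(x),\nabla u(x),D^2u(x))$ be a second order partial differential operator on $\Omega$. Let $F_M^\epsilon$ be a monotone approximation scheme and $F_A^\epsilon$ another approximation scheme for $F$, and suppose that the formal discretization errors of the schemes $F_A^\epsilon$, $F_M^\epsilon$ are $\mathcal{O}(\epsilon^{\beta_A})$ and $\mathcal{O}(\epsilon^{\beta_M})$ respectively. Choose the parameter $\alpha$ so that $\beta_A>\beta_M>\alpha>0$. Let $S$ be a filter function and let $F^\epsilon$ be the filtered scheme $$F^\epsilon[u]=F_M^\epsilon[u]+\epsilon^\alpha\,S\!\left(\frac{F_A^\epsilon[u]-F_M^\epsilon[u]}{\epsilon^\alpha}\right).$$ If $\phi$ is smooth, then $F^\epsilon[\phi]=F_A^\epsilon[\phi]$.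
   Context: **Approximation scheme:** a family of functions $F^\epsilon$, parameterized by $\epsilon>0$, assigning a real number $F^\epsilon(x,r,v(\cdot))$ to each $x\in\Omega$, $r\in\mathbb{R}$ and bounded function $v$ on $\Omega$; write $F^\epsilon[v](x)=F^\epsilon(x,v(x),v(\cdot))$, where $\epsilon>0$ is small. **Discretization error:** a scheme $F^\epsilon$ has formal discretization error $\mathcal{O}(\epsilon^{\beta})$ (is accurate to $\mathcal{O}(\epsilon^\beta)$) if for any smooth function $\phi$ and $x\in\Omega$, $F^\epsilon[\phi]-F[\phi]=\mathcal{O}(\epsilon^{\beta})$. **Monotone:** for every $\epsilon>0$, $x$, $s\in\mathbb{R}$ and bounded $v\ge w$, $F_M^\epsilon(x,s,v(\cdot))\le F_M^\epsilon(x,s,w(\cdot))$. **Filter function:** a continuous, bounded function $S:\mathbb{R}\to\mathbb{R}$ which is equal to the identity in a neighbourhood of the origin and zero outside (a larger neighbourhood); for example $S(x)=x$ for $|x|\le1$, $S(x)=0$ for $|x|\ge2$, $S(x)=-x+2$ for $1\le x\le2$, $S(x)=-x-2$ for $-2\le x\le-1$. *)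

(* Defs.v *)
From HB Require Import structures.
From mathcomp Require Import all_boot all_order all_algebra.
From mathcomp Require Import all_classical all_reals all_analysis.

Set Implicit Arguments.
Unset Strict Implicit.
Unset Printing Implicit Defensive.

Import Order.TTheory GRing.Theory Num.Theory.
Import numFieldNormedType.Exports.

Local Open Scope classical_set_scope.
Local Open Scope ring_scope.

Section FunctionsOnDomain.
Variables (R : realType) (d : nat) (Omega : set 'rV[R]_d).

Record bounded_function := BoundedFunction {
  bfun_val :> Omega -> R;
  bfun_bounded : bounded_fun bfun_val }.

(* A function on Omega extended by 0. As Omega is open in all uses, limits,
   and hence derivatives, at points of Omega do not depend on the extension. *)
Definition extend (u : Omega -> R) : 'rV[R]_d -> R := valL_ 0 u.

Definition partial (i : 'I_d) (f : 'rV[R]_d -> R) : 'rV[R]_d -> R :=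
  fun x => 'D_(delta_mx 0 i) f x.

(* s lists, outermost first, the coordinates of successive differentiation. *)
Definition partials (s : seq 'I_d) (f : 'rV[R]_d -> R) : 'rV[R]_d -> R :=
  foldr partial f s.

Definition smooth (u : Omega -> R) : Prop :=
  forall (s : seq 'I_d) (x : 'rV[R]_d), Omega x ->
    {for x, continuous (partials s (extend u))} /\
    (forall i : 'I_d, derivable (partials s (extend u)) x (delta_mx 0 i)).

Definition gradient (u : Omega -> R) (x : Omega) : 'rV[R]_d :=
  \row_i partial i (extend u) (set_val x).

Definition hessian (u : Omega -> R) (x : Omega) : 'M[R]_d :=
  \matrix_(i, j) partial i (partial j (extend u)) (set_val x).

Definition pde_function := Omega -> R -> 'rV[R]_d -> 'M[R]_d -> R.

Definition pde_operator (F : pde_function) (u : Omega -> R) (x : Omega) : R :=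
  F x (u x) (gradient u x) (hessian u x).

(* The first argument is the parameter epsilon; only its positive values are
   ever used. *)
Definition scheme := R -> Omega -> R -> bounded_function -> R.

Definition scheme_at (G : scheme) (e : R) (v : bounded_function)
    (x : Omega) : R :=
  G e x (v x) v.

Definition monotone_scheme (G : scheme) : Prop :=
  forall e : R, 0 < e ->
  forall (x : Omega) (s : R) (v w : bounded_function),
    (forall y, w y <= v y) -> G e x s v <= G e x s w.

Definition discretization_error (F : pde_function) (G : scheme) (beta : R) :
    Prop :=
  forall phi : bounded_function, smooth phi -> forall x : Omega,
    (fun e : R => scheme_at G e phi x - pde_operator F phi x)
      =O_ (0^'+) (fun e : R => e `^ beta).

Definition filtered_scheme (alpha : R) (S : R -> R) (GM GA : scheme) :
    scheme :=
  fun e x r v =>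
    GM e x r v + e `^ alpha * S ((GA e x r v - GM e x r v) / e `^ alpha).

End FunctionsOnDomain.

Definition filter_function (R : realType) (S : R -> R) : Prop :=
  [/\ continuous S, bounded_fun S &
      exists r1 r2 : R, [/\ 0 < r1, r1 < r2,
        (forall t, `|t| <= r1 -> S t = t) &
        (forall t, r2 <= `|t| -> S t = 0)]].

(* Main.v *)
Require Import Defs.
From mathcomp Require Import all_boot all_order all_algebra.
From mathcomp Require Import all_classical all_reals all_analysis.
Import Order.TTheory GRing.Theory Num.Theory.
Import numFieldNormedType.Exports.
Local Open Scope classical_set_scope.
Local Open Scope ring_scope.

(** Both error exponents exceed [alpha], so at a fixed point [x] each scheme differs from the
    operator applied to [phi] by o(e^alpha) ([discretization_error_littleo]). Hence the quotient fed
    to [S] tends to 0 and eventually lies where [S] is the identity; there the factors e^alpha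
    cancel and the filtered scheme collapses to FM + (FA - FM) = FA. The threshold on [e] may depend
    on [x]. *)

Lemma powR_littleo {R : realType} {a b : R} : a < b ->
  (fun e : R => e `^ b) =o_ (0^'+) (fun e : R => e `^ a).
Proof.
move=> ab; apply/eqoP => eps eps_gt0.
have ba_gt0 : 0 < b - a by rewrite subr_gt0.
(* The ratio of the two powers is e^(b - a), which tends to 0 because its exponent is positive. *)
have /cvgr0Pnorm_le/(_ _ eps_gt0) ba_small := powR_cvg0 ba_gt0.
near=> e.
have e_gt0 : 0 < e by [].
have -> : e `^ b = e `^ (b - a) * e `^ a.
  by rewrite -powRD ?subrK// [e == 0]gt_eqF// implybT.
by rewrite normrM ler_wpM2r//; near: e.
Unshelve. all: by end_near. Qed.

(** An error O(e^beta) is o(e^alpha), since e^beta itself is. *)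
Lemma discretization_error_littleo {R : realType} {d : nat}
    {Omega : set 'rV[R]_d} {F : pde_function Omega} {G : scheme Omega}
    {alpha beta : R} {phi : bounded_function Omega} (x : Omega) :
  alpha < beta -> discretization_error F G beta -> smooth phi ->
  (fun e : R => scheme_at G e phi x - pde_operator F phi x)
    =o_ (0^'+) (fun e : R => e `^ alpha).
Proof.
move=> alpha_beta G_error phi_smooth.
exact: eqOo_trans (G_error _ phi_smooth x) (powR_littleo alpha_beta).
Qed.

Theorem lemma4 (R : realType) (d : nat) (Omega : set 'rV[R]_d)
  (Omega_open : open Omega)
  (F : pde_function Omega) (FM FA : scheme Omega)
  (FM_monotone : monotone_scheme FM)
  (betaA betaM alpha : R)
  (FA_error : discretization_error F FA betaA)
  (FM_error : discretization_error F FM betaM)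
  (betaMA : betaM < betaA) (alpha_betaM : alpha < betaM) (alpha_gt0 : 0 < alpha)
  (S : R -> R) (S_filter : filter_function S)
  (phi : bounded_function Omega) (phi_smooth : smooth phi) (x : Omega) :
  \forall e \near 0^'+,
    scheme_at (filtered_scheme alpha S FM FA) e phi x = scheme_at FA e phi x.
Proof.
have [_ _ [r1 [_ [r1_gt0 _ S_id _]]]] := S_filter.
(* Each scheme's error is allotted half of the radius [r1] on which [S] is the identity. *)
have r12_gt0 : 0 < r1 / 2 by rewrite divr_gt0.
have alpha_betaA : alpha < betaA := lt_trans alpha_betaM betaMA.
have /eqoP/(_ _ r12_gt0) A_small :=
  discretization_error_littleo x alpha_betaA FA_error phi_smooth.
have /eqoP/(_ _ r12_gt0) M_small :=
  discretization_error_littleo x alpha_betaM FM_error phi_smooth.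
near=> e.
have e_gt0 : 0 < e by [].
have ea_gt0 : 0 < e `^ alpha by rewrite powR_gt0.
have diff_le : `|scheme_at FA e phi x - scheme_at FM e phi x| <= r1 * e `^ alpha.
  (* Inserting the exact value of the operator splits the gap between the schemes into their two
     errors. *)
  rewrite -(subrKA (pde_operator F phi x)) -[pde_operator F phi x - _]opprB.
  apply: le_trans (ler_normB _ _) _.
  rewrite [r1]splitr mulrDl -[e `^ alpha]gtr0_norm//.
  by apply: lerD; near: e.
(* [S_id] leaves the cancellation and the bound of the quotient by [r1], which is [diff_le] divided
   by e^alpha. *)
rewrite /scheme_at /filtered_scheme -!/(scheme_at _ _ _ _) S_id.
  by rewrite mulrC divfK ?gt_eqF// addrC subrK.
by rewrite normrM normfV (gtr0_norm ea_gt0) ler_pdivrMr.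
Unshelve. all: by end_near. Qed.
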